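(* Let $\mathcal{A}=\{A_1,\dots,A_m\}$ be a finite set of real matrices with $A_i\in\mathbb{R}^{n\times n}$ for $i\in[m]$, and let $\mathcal{M}=(Q,U,f)$ be a deterministic finite automaton with $Q=\{q_1,\dots,q_\ell\}$ and $U=\{1,\dots,m\}$. For $i\in[m]$ let $F_i\in\mathbb{R}^{\ell\times\ell}$ be the matrix whose $(s,t)$ entry is $1$ if $f(q_t,i)$ is defined and $q_s=f(q_t,i)$, and $0$ otherwise. Let $\Phi_i=F_i\otimes A_i\in\mathbb{R}^{n\ell\times n\ell}$ (Kronecker product) and $\mathcal{A}_{\mathcal{M}}=\{\Phi_1,\dots,\Phi_m\}$. Then $$\rho(\mathcal{A},\mathcal{M})=\bar\rho(\mathcal{A},\mathcal{M})=\rho(\mathcal{A}_{\mathcal{M}})=\bar\rho(\mathcal{A}_{\mathcal{M}}),$$ where $\rho(\mathcal{A},\mathcal{M})$ and $\bar\rho(\mathcal{A},\mathcal{M})$ are the constrained joint spectral radius and the constrained generalized spectral radius of the constrained switching system $S(\mathcal{A},\mathcal{M})$, and $\rho(\mathcal{A}_{\mathcal{M}})$ and $\bar\rho(\mathcal{A}_{\mathcal{M}})$ are the joint spectral radius and the generalized spectral radius of $\mathcal{A}_{\mathcal{M}}$.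
   Context: Notation: $[m]=\{1,\dots,m\}$; $n,m,\ell$ are positive integers. Deterministic finite automaton (DFA): a triple $\mathcal{M}=(Q,U,f)$ with $Q=\{q_1,\dots,q_\ell\}$ a finite set of states, $U=\{1,\dots,m\}$ a finite set of input symbols, and $f:Q\times U\to Q$ a transition function, which is a partial function (it need not be defined on all state-input pairs). It is assumed throughout that for each $q\in Q$ there is at least one $u\in U$ such that $f(q,u)$ is defined. There are no designated initial or accepting states. Accepted sequences: a finite sequence $\sigma=\sigma_1\dots\sigma_k$ of elements of $U$ is accepted by $\mathcal{M}$ if there is a state sequence $q_{j_1}q_{j_2}\dots q_{j_{k+1}}$ in $Q$ such that, for $i=1,\dots,k$, $f(q_{j_i},\sigma_i)$ is defined and $q_{j_{i+1}}=f(q_{j_i},\sigma_i)$ (the starting state is arbitrary). $L(\mathcal{M})$ denotes the set of sequences accepted by $\mathcal{M}$. Matrix products: for $\mathcal{B}=\{B_1,\dots,B_m\}$ a finite indexed set of square real matrices of the same size and $\sigma=\sigma_0\dots\sigma_{k-1}\in[m]^k$, put $B_\sigma=B_{\sigma_{k-1}}\cdots B_{\sigma_0}$. For a single matrix $B$, $\rho(B)$ is its usual spectral radius. $\|\cdot\|$ denotes any given sub-multiplicative matrix norm on square matrices of the relevant size (the quantities below defined using it do not depend on the choice of norm). Joint spectral radius (JSR): $\rho(\mathcal{B})=\limsup_{k\to\infty}\rho_k(\mathcal{B})^{1/k}$, where $\rho_k(\mathcal{B})=\max_{\sigma\in[m]^k}\|B_\sigma\|$. Generalized spectral radius (GSR):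 $\bar\rho(\mathcal{B})=\limsup_{k\to\infty}\bar\rho_k(\mathcal{B})^{1/k}$, where $\bar\rho_k(\mathcal{B})=\max_{\sigma\in[m]^k}\rho(B_\sigma)$. Constrained switching system $S(\mathcal{A},\mathcal{M})$: the system $x_{k+1}=A_{\sigma_k}x_k$ with $x_k\in\mathbb{R}^n$, where the switching sequence $\sigma_0\sigma_1\dots$ is required to belong to $L(\mathcal{M})$. Constrained joint spectral radius (CJSR): $\rho(\mathcal{A},\mathcal{M})=\limsup_{k\to\infty}\rho_k(\mathcal{A},\mathcal{M})^{1/k}$, where $\rho_k(\mathcal{A},\mathcal{M})=\max\{\|A_\sigma\|:\sigma\in[m]^k,\ \sigma\in L(\mathcal{M})\}$. Constrained generalized spectral radius (CGSR): $\bar\rho(\mathcal{A},\mathcal{M})=\limsup_{k\to\infty}\bar\rho_k(\mathcal{A},\mathcal{M})^{1/k}$, where $\bar\rho_k(\mathcal{A},\mathcal{M})=\max\{\rho(A_\sigma):\sigma\in[m]^k,\ \sigma\in L(\mathcal{M})\}$. *)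

(* Defs.v *)
From HB Require Import structures.
From mathcomp Require Import all_boot all_order all_algebra.
From mathcomp Require Import all_classical all_reals all_analysis.
From mathcomp Require Import complex mxtens.

Set Implicit Arguments.
Unset Strict Implicit.
Unset Printing Implicit Defensive.

Import Order.TTheory GRing.Theory Num.Theory.
Local Open Scope ring_scope.

(* States and symbols are numbered from 0. [dfa_trans M q u = None] means that
   the partial transition function is undefined at (q, u). *)
Record dfa (l m : nat) := Dfa {
  dfa_trans : 'I_l -> 'I_m -> option 'I_l;
  dfa_live : forall q : 'I_l, exists u : 'I_m, dfa_trans q u <> None }.

(* In the state sequence q, the index [widen_ord (leqnSn k) i] is i and
   [lift ord0 i] is i + 1. *)
Definition accepted (l m : nat) (M : dfa l m) (k : nat) (s : k.-tuple 'I_m)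
    : bool :=
  [exists q : {ffun 'I_k.+1 -> 'I_l}, [forall i : 'I_k,
     dfa_trans M (q (widen_ord (leqnSn k) i)) (tnth s i)
       == Some (q (lift ord0 i))]].

(* B_s = B_{s_(k-1)} ... B_{s_0}: the first symbol acts first on column
   vectors, hence the reversal. *)
Definition mxword (R : realType) (m n : nat) (B : 'I_m -> 'M[R]_n)
    (s : seq 'I_m) : 'M[R]_n :=
  \prod_(i <- rev s) B i.

Definition submult_norm (R : realType) (n : nat) (N : 'M[R]_n -> R) : Prop :=
  [/\ forall X, N X = 0 -> X = 0,
      forall (a : R) X, N (a *: X) = `|a| * N X,
      forall X Y, N (X + Y) <= N X + N Y
    & forall X Y, N (X *m Y) <= N X * N Y].

(* For n > 0 the set below is finite and nonempty, so its sup is a max. *)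
Definition spectral_radius (R : realType) (n : nat) (X : 'M[R]_n) : R :=
  sup [set r : R | exists2 z : R[i],
         eigenvalue (map_mx (real_complex R) X) z
       & r = ComplexField.Normc.normc z]%classic.

(* The limsup is taken in the extended reals so that it is meaningful without
   a boundedness proof. The value of the sequence at k = 0 is irrelevant. *)
Definition limsup_root (R : realType) (u : nat -> R) : \bar R :=
  limn_esup (fun k => (u k `^ k%:R^-1)%:E).

(* In the four definitions below the maxima are of nonnegative quantities, so
   the base value 0 of the iterated max does not affect them. *)
Definition jsr (R : realType) (m n : nat) (N : 'M[R]_n -> R)
    (B : 'I_m -> 'M[R]_n) : \bar R :=
  limsup_root (fun k => \big[Num.max/0]_(s : k.-tuple 'I_m) N (mxword B s)).

Definition gsr (R : realType) (m n : nat) (B : 'I_m -> 'M[R]_n) : \bar R :=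
  limsup_root (fun k =>
    \big[Num.max/0]_(s : k.-tuple 'I_m) spectral_radius (mxword B s)).

Definition cjsr (R : realType) (l m n : nat) (N : 'M[R]_n -> R)
    (A : 'I_m -> 'M[R]_n) (M : dfa l m) : \bar R :=
  limsup_root (fun k =>
    \big[Num.max/0]_(s : k.-tuple 'I_m | accepted M s) N (mxword A s)).

Definition cgsr (R : realType) (l m n : nat)
    (A : 'I_m -> 'M[R]_n) (M : dfa l m) : \bar R :=
  limsup_root (fun k =>
    \big[Num.max/0]_(s : k.-tuple 'I_m | accepted M s)
      spectral_radius (mxword A s)).

Definition trans_mx (R : realType) (l m : nat) (M : dfa l m) (i : 'I_m)
    : 'M[R]_l :=
  \matrix_(s < l, t < l) (dfa_trans M t i == Some s)%:R.

Definition lifted_mx (R : realType) (l m n : nat) (A : 'I_m -> 'M[R]_n)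
    (M : dfa l m) (i : 'I_m) : 'M[R]_(l * n) :=
  trans_mx R M i *t A i.

(* Main.v *)
Require Import Defs.
From mathcomp Require Import all_boot all_order all_algebra.
From mathcomp Require Import all_classical all_reals all_analysis.
From mathcomp Require Import complex mxtens ring lra.

(** The four quantities are equal because they form the cycle
      jsr(lift) <= cgsr <= cjsr <= jsr(lift),
    to which gsr(lift) is attached by the Berger-Wang theorem
    jsr(lift) = gsr(lift).

    Two of the inequalities are soft. A spectral radius is at most any
    submultiplicative norm, which gives cgsr <= cjsr and gsr <= jsr
    ([spectral_radius_le_submult_norm]). For a word s the lifted product is
    F_s (x) A_s, where F_s is the 0/1 matrix of the partial map s induces on
    the states; when s is accepted, A_s is literally a block of the lifted
    product, whence cjsr <= jsr(lift) ([cjsr_le_jsr_lifted]).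

    The two hard inequalities, jsr(lift) <= cgsr and jsr(lift) <= gsr(lift),
    both bound norms of products by spectral radii, and both go through
    traces: |tr X| <= n rho(X), and moreover
    tr (F_s (x) A_s) = tr F_s * tr A_s vanishes unless s is accepted and is at
    most l n rho(A_s) otherwise. So both follow from one fact on a finite
    family of matrices ([trace_bound_norm_bound]): if the traces of the
    products of length k are O(c1^k) and c1 < c, then the norms of the
    products of length k are O(c^k).

    To see this, let A be the algebra spanned by all products and I the
    radical of the trace form (X, Y) |-> tr (X Y) on A. Modulo I the trace form
    is nondegenerate, so a product W of length k is Y + Z, where Z is in I and
    Y is a combination of fixed matrices with the traces tr (W W_i) as
    coefficients, W_i running over finitely many products; hence Y is
    O(c1^k) ([word_trace_decomposition]). The elements of I have powers of
    trace zero, so they are nilpotent ([trace_powers_nilpotent]), and an ideal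
    of nilpotent matrices acts nilpotently along a flag of A-stable subspaces
    ([nil_ideal_flag]). Cut a long word into blocks of a fixed large length and
    expand the product of the Y + Z: the terms with n factors Z or more
    vanish, and those that remain contain small factors Y almost everywhere. *)

Set Implicit Arguments.
Unset Strict Implicit.
Unset Printing Implicit Defensive.

Import Order.TTheory GRing.Theory Num.Theory.
Import numFieldNormedType.Exports.
Local Open Scope ring_scope.

(** * Matrices whose powers have trace zero *)

(** In the trace of the Cayley-Hamilton identity only the constant coefficient
    survives, and it is the determinant up to sign; characteristic 0 lets the
    factor r be cancelled. *)
Lemma trace_powers_singular (F : numFieldType) (r : nat) (G : 'M[F]_r) :
  (0 < r)%N -> (forall k, \tr (G ^+ k.+1) = 0) -> G \notin unitmx.
Proof.
case: r G => // r G _ trG; rewrite unitmxE unitfE negbK.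
have := Cayley_Hamilton G; have := char_poly_det G; have := size_char_poly G.
move: (char_poly G) => p size_p p0 /(congr1 mxtrace).
rewrite [horner_mx G p]horner_coef size_map_poly size_p.
rewrite big_ord_recl raddfD raddf_sum /= big1 ?addr0 => [|i _]; last first.
  by rewrite coef_map /= -mulmxE mul_scalar_mx mxtraceZ trG mulr0.
rewrite coef_map /= expr0 mulr1 mxtrace_scalar p0 mxtrace0 => /eqP.
by rewrite -mulr_natr mulf_eq0 pnatr_eq0 orbF mulf_eq0 signr_eq0.
Qed.

(** A power Y of X of minimal rank r factors as C D through dimension r, and
    G = D C has the same power traces as Y. Since Y^2 = C G D still has rank r,
    G is invertible, which forces r = 0. *)
Lemma trace_powers_nilpotent (F : numFieldType) (n : nat) (X : 'M[F]_n) :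
  (forall k, \tr (X ^+ k.+1) = 0) -> exists k, X ^+ k = 0.
Proof.
move=> trX; pose P r := `[< exists k, \rank (X ^+ k.+1) = r >].
have exP : exists r, P r by exists (\rank X); apply/asboolP; exists 0.
case: (ex_minnP exP) => r /asboolP[k rkY] minr.
set Y := X ^+ k.+1 in rkY.
have [C [D defY]] : exists (C : 'M[F]_(n, \rank Y)) D, C *m D = Y.
  by exists (col_base Y), (row_base Y); exact: mulmx_base.
set G := D *m C.
have trG j : \tr (G ^+ j.+1) = 0.
  have -> : G ^+ j.+1 = D *m (Y ^+ j *m C).
    elim: j => [|j IHj]; first by rewrite mul1mx.
    by rewrite exprS IHj [in RHS]exprS -!mulmxE /G -!mulmxA (mulmxA C) defY.
  by rewrite mxtrace_mulC -mulmxA defY mulmxE -exprSr -exprM mulSn trX.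
have Gfull : G \in unitmx.
  rewrite -row_free_unit /row_free eqn_leq rank_leq_row /= {1}rkY.
  apply: (leq_trans (minr (\rank (Y *m Y)) _)).
    by apply/asboolP; exists (k + k.+1)%N; rewrite mulmxE /Y -exprD.
  have -> : Y *m Y = C *m (G *m D) by rewrite /G -!mulmxA (mulmxA C) defY.
  exact: leq_trans (mxrankM_maxr _ _) (mxrankM_maxl _ _).
exists k.+1; apply/eqP; rewrite -mxrank_eq0 -leqn0 leqNgt.
by apply/negP => /trace_powers_singular/(_ trG); rewrite Gfull.
Qed.

(** * Ideals of nilpotent matrices *)

(** Finitely many values of a family of vectors already span all of them: take
    a finite subfamily of maximal rank. *)
Lemma finite_spanning (F : fieldType) (T : Type) (d : nat) (f : T -> 'rV[F]_d) :
  exists (p : nat) (t : 'I_p -> T), forall x, (f x <= \matrix_i f (t i))%MS.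
Proof.
pose P r := `[< exists (p : nat) (t : 'I_p -> T), \rank (\matrix_i f (t i)) = r >].
have exP : exists r, P r.
  have t0 : 'I_0 -> T by case.
  by exists (\rank (\matrix_i f (t0 i))); apply/asboolP; exists 0, t0.
have leP r : P r -> (r <= d)%N by move=> /asboolP[p [t <-]]; exact: rank_leq_col.
case: (ex_maxnP exP leP) => r /asboolP[p [t rkt]] maxr.
exists p, t => x; apply: contraT => fx.
pose t' (i : 'I_p.+1) := oapp t x (unlift ord0 i).
have sub : ((\matrix_i f (t i)) < \matrix_i f (t' i))%MS.
  apply/andP; split; last first.
    apply: contra fx => /row_subP/(_ ord0).
    by rewrite rowK /t' unlift_none.
  apply/row_subP => i; rewrite rowK; apply: (eq_row_sub (lift ord0 i)).
  by rewrite rowK /t' liftK.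
have := leq_trans (rank_ltmx sub) (maxr _ _); rewrite rkt ltnn; apply.
by apply/asboolP; exists p.+1, t'.
Qed.

(** Lets a subspace be described by a predicate and then used with the rank and
    inclusion calculus of row spaces. *)
Lemma subspace_rowspace (F : fieldType) (n : nat) (P : 'rV[F]_n -> Prop) :
  P 0 -> (forall a u v, P u -> P v -> P (a *: u + v)) ->
  exists U : 'M[F]_n, forall v, (v <= U)%MS <-> P v.
Proof.
move=> P0 Plin; have [p [t tP]] := finite_spanning (fun v : {v | P v} => sval v).
exists <<\matrix_i sval (t i)>>%MS => v; rewrite genmxE; split=> [|Pv].
  move=> /submxP[D ->]; rewrite mulmx_sum_row.
  elim/big_ind: _ => // [u w Pu Pw|i _]; first by rewrite -[u]scale1r; exact: Plin.
  by rewrite rowK -[_ *: _]addr0; apply: Plin => //; exact: svalP.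
exact: tP (exist _ v Pv).
Qed.

(** For U nonzero, V is a maximal proper A-stable subspace of U. If u Z were outside V for some
    u in U and Z in I, then V + u I would be stable and larger than V, hence all
    of U; so u = v + u Z' with v in V and Z' in I, and iterating this
    congruence u = u Z' modulo V up to the nilpotency index of Z' gives
    u in V, a contradiction. *)
Lemma maximal_stable_absorbs (F : fieldType) (n : nat) (A I : 'M[F]_n -> Prop)
    (I0 : I 0) (Ilin : forall a X Y, I X -> I Y -> I (a *: X + Y))
    (IA : forall X, I X -> A X) (IM : forall X Y, I X -> A Y -> I (X *m Y))
    (Inil : forall X, I X -> exists k, X ^+ k = 0) (U : 'M[F]_n) :
  (forall X, A X -> (U *m X <= U)%MS) ->
  exists V : 'M[F]_n, [/\ forall X, A X -> (V *m X <= V)%MS,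
    forall X, I X -> (U *m X <= V)%MS & (\rank V <= (\rank U).-1)%N].
Proof.
move=> stU; case: (posnP (\rank U)) => [U0|Ugt0].
  exists U; split=> //; last by rewrite U0.
  by move=> X /IA/stU.
pose P r := `[< exists V : 'M[F]_n, [/\ \rank V = r, forall X, A X -> (V *m X <= V)%MS,
   (V <= U)%MS & (r < \rank U)%N] >].
have exP : exists r, P r.
  exists 0%N; apply/asboolP; exists 0; split=> //; rewrite ?mxrank0 ?sub0mx //.
  by move=> X _; rewrite mul0mx sub0mx.
have leP r : P r -> (r <= \rank U)%N by move=> /asboolP[V [_ _ _ /ltnW]].
case: (ex_maxnP exP leP) => r /asboolP[V [rkV stV VU ltVU]] maxr.
exists V; split=> //; last by rewrite -ltnS prednK // rkV.
move=> X IX; apply/row_subP => i; rewrite row_mul; set u := row i U.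
have uU : (u <= U)%MS by exact: row_sub.
apply: contraT => uXV.
have [||W WP] := @subspace_rowspace F n
  (fun v => exists v' Z, [/\ (v' <= V)%MS, I Z & v = v' + u *m Z]).
- by exists 0, 0; rewrite sub0mx mulmx0 addr0.
- move=> a _ _ [v1 [Z1 [v1V IZ1 ->]]] [v2 [Z2 [v2V IZ2 ->]]].
  exists (a *: v1 + v2), (a *: Z1 + Z2); split; last 1 first.
  + by rewrite mulmxDr scalerDr -scalemxAr addrACA.
  + by rewrite addmx_sub ?scalemx_sub.
  + exact: Ilin.
have VW : (V <= W)%MS.
  apply/row_subP => j; apply/WP; exists (row j V), 0.
  by rewrite row_sub mulmx0 addr0.
have WU : (W <= U)%MS.
  apply/row_subP => j; have /WP[v [Z [vV IZ ->]]] := row_sub j W.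
  rewrite addmx_sub ?(submx_trans vV) //.
  by rewrite (submx_trans (submxMr Z uU)) // stU //; exact: IA.
have stW Y : A Y -> (W *m Y <= W)%MS.
  move=> AY; apply/row_subP => j; rewrite row_mul.
  have /WP[v [Z [vV IZ ->]]] := row_sub j W.
  apply/WP; exists (v *m Y), (Z *m Y); split; last by rewrite mulmxDl mulmxA.
    by rewrite (submx_trans (submxMr Y vV)) // stV.
  exact: IM.
have ltVW : (V < W)%MS.
  rewrite /ltmx VW; apply: contra uXV; apply: submx_trans.
  by apply/WP; exists 0, X; rewrite sub0mx add0r.
have UW : (U <= W)%MS.
  apply: contraT => UW; have WltU : (W < U)%MS by rewrite /ltmx WU.
  have := leq_trans (rank_ltmx ltVW) (maxr (\rank W) _).
  rewrite rkV ltnn; apply; apply/asboolP; exists W; split=> //.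
  exact: rank_ltmx.
have /WP[v [Z [vV IZ uE]]] := submx_trans uU UW.
have uZ k : (u - u *m Z ^+ k <= V)%MS.
  elim: k => [|k IHk]; first by rewrite expr0 mulmx1 subrr sub0mx.
  rewrite {1}uE exprSr -mulmxE mulmxA -addrA -mulmxBl.
  by rewrite addmx_sub // (submx_trans (submxMr Z IHk)) // stV //; exact: IA.
have [k Zk] := Inil _ IZ; have := uZ k; rewrite Zk mulmx0 subr0 => uV.
case/negP: uXV; apply: submx_trans (submxMr X uV) _.
by apply: stV; exact: IA.
Qed.

(** Each step of the flag loses at least one dimension, so n steps reach 0. *)
Lemma nil_ideal_flag (F : fieldType) (n : nat) (A I : 'M[F]_n -> Prop)
    (I0 : I 0) (Ilin : forall a X Y, I X -> I Y -> I (a *: X + Y))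
    (IA : forall X, I X -> A X) (IM : forall X Y, I X -> A Y -> I (X *m Y))
    (Inil : forall X, I X -> exists k, X ^+ k = 0) :
  exists U : nat -> 'M[F]_n, [/\ U 0%N = 1%:M, U n = 0,
    forall j X, A X -> (U j *m X <= U j)%MS &
    forall j X, I X -> (U j *m X <= U j.+1)%MS].
Proof.
pose st (U : 'M[F]_n) := forall X, A X -> (U *m X <= U)%MS.
have /choice[f fP] : forall U, exists V, st U ->
   [/\ st V, forall X, I X -> (U *m X <= V)%MS & (\rank V <= (\rank U).-1)%N].
  move=> U; have [stU|nstU] := pselect (st U); last by exists U.
  have [V VP] := maximal_stable_absorbs I0 Ilin IA IM Inil stU.
  by exists V.
pose U j := iter j f 1%:M.
have stU j : st (U j).
  by elim: j => [X _|j /fP[]//]; rewrite submx1.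
have rkU j : (\rank (U j) <= n - j)%N.
  elim: j => [|j IHj]; first by rewrite mxrank1 subn0.
  have [_ _ /leq_trans] := fP _ (stU j); apply.
  by rewrite subnS -!subn1 leq_sub2r.
exists U; split=> //.
  by apply/eqP; rewrite -mxrank_eq0 -leqn0 -(subnn n).
by move=> j X IX; have [_ ->] := fP _ (stU j).
Qed.

(** The matrices D i depend on the family only, so the first summand of
      W s = Y + (W s - Y),   Y = sum_i tr (W (s ++ w i)) D i,
    is small as soon as the traces of long words are. The second summand lies in
    the radical I of the trace form on the span A of all words; A and I are
    exposed only through their action on the flag U. *)
Lemma word_trace_decomposition (F : numFieldType) (T : Type) (n : nat)
    (W : seq T -> 'M[F]_n) (W0 : W [::] = 1%:M)
    (WM : forall s t, W (s ++ t) = W s *m W t) :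
  exists (A I : 'M[F]_n -> Prop) (p : nat) (w : 'I_p -> seq T)
    (D : 'I_p -> 'M[F]_n) (U : nat -> 'M[F]_n),
  [/\ forall s, A (\sum_i \tr (W (s ++ w i)) *: D i),
      forall s, I (W s - \sum_i \tr (W (s ++ w i)) *: D i) &
   [/\ U 0%N = 1%:M, U n = 0,
    forall j X, A X -> (U j *m X <= U j)%MS &
    forall j X, I X -> (U j *m X <= U j.+1)%MS]].
Proof.
have [p [w wP]] := finite_spanning (fun s => mxvec (W s)).
pose A X := exists x : 'rV[F]_p, X = \sum_i x 0 i *: W (w i).
pose I X := A X /\ forall s, \tr (X *m W s) = 0.
have A0 : A 0.
  by exists 0; rewrite big1 // => i _; rewrite mxE scale0r.
have Alin a X Y : A X -> A Y -> A (a *: X + Y).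
  move=> [x ->] [y ->]; exists (a *: x + y).
  rewrite scaler_sumr -big_split; apply: eq_bigr => i _.
  by rewrite !mxE scalerDl scalerA.
have Asum q (c : 'I_q -> F) Z : (forall i, A (Z i)) -> A (\sum_i c i *: Z i).
  move=> AZ; apply: (big_ind A) => // [X Y AX AY|i _].
    by rewrite -[X]scale1r; exact: Alin.
  by rewrite -[_ *: _]addr0; exact: Alin.
have AW s : A (W s).
  have /submxP[x xE] := wP s; exists x.
  apply: (can_inj mxvecK); rewrite xE mulmx_sum_row linear_sum.
  by apply: eq_bigr => i _; rewrite rowK linearZ.
have AM X Y : A X -> A Y -> A (X *m Y).
  move=> [x ->] [y ->]; rewrite mulmx_suml.
  under eq_bigr do rewrite -scalemxAl.
  apply: (Asum p) => i; rewrite mulmx_sumr.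
  under eq_bigr do rewrite -scalemxAr.
  by apply: (Asum p) => j; rewrite -WM.
have trI X Y : I X -> A Y -> \tr (X *m Y) = 0.
  move=> [_ trX] [y ->]; rewrite mulmx_sumr raddf_sum /= big1 // => i _.
  by rewrite -scalemxAr mxtraceZ trX mulr0.
have IM X Y : I X -> A Y -> I (X *m Y).
  move=> IX AY; split=> [|s]; first by case: IX => AX _; exact: AM.
  by rewrite -mulmxA trI //; exact: AM.
have Ilin a X Y : I X -> I Y -> I (a *: X + Y).
  move=> [AX tX] [AY tY]; split=> [|s]; first exact: Alin.
  by rewrite mulmxDl -scalemxAl mxtraceD mxtraceZ tX tY mulr0 addr0.
have I0 : I 0 by split=> // s; rewrite mul0mx mxtrace0.
have IA X : I X -> A X by case.
have AX k X : A X -> A (X ^+ k).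
  move=> AX; elim: k => [|k IHk]; first by rewrite expr0 -[1]/(1%:M) -W0.
  by rewrite exprS -mulmxE; exact: AM.
have Inil X : I X -> exists k, X ^+ k = 0.
  move=> IX; apply: trace_powers_nilpotent => k.
  by rewrite exprS -mulmxE trI //; apply: AX; exact: IA.
have [U UP] := nil_ideal_flag I0 Ilin IA IM Inil.
(* G is the Gram matrix of the trace form on the words w i, and its partial
   inverse yields D as a substitute for a dual family although the form may
   be degenerate. *)
pose G := \matrix_(i, j) \tr (W (w i) *m W (w j)).
pose D j := \sum_i pinvmx G j i *: W (w i).
have AD s : A (\sum_i \tr (W (s ++ w i)) *: D i).
  by apply: (Asum p) => i; apply: (Asum p) => j; exact: AW.
have trG (z : 'rV[F]_p) j : \tr ((\sum_i z 0 i *: W (w i)) *m W (w j)) = (z *m G) 0 j.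
  rewrite mulmx_suml (raddf_sum (@mxtrace F n)) mxE; apply: eq_bigr => k _.
  by rewrite mxE -scalemxAl -mxtraceZ.
exists A, I, p, w, D, U; split=> // s; split.
  by rewrite addrC -scaleN1r; apply: Alin.
move=> t; have trW j :
    \tr ((W s - \sum_i \tr (W (s ++ w i)) *: D i) *m W (w j)) = 0.
  have [x xE] := AW s; pose y := x *m G *m pinvmx G.
  have -> : \sum_i \tr (W (s ++ w i)) *: D i = \sum_k y 0 k *: W (w k).
    under eq_bigr do rewrite scaler_sumr.
    rewrite exchange_big /=; apply: eq_bigr => k _.
    rewrite mxE scaler_suml; apply: eq_bigr => i _.
    by rewrite scalerA -trG -xE WM.
  rewrite mulmxBl (raddfB (@mxtrace F n)) /= xE !trG.
  by rewrite mulmxKpV ?subrr // submxMl.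
have [x ->] := AW t; rewrite mulmx_sumr raddf_sum /= big1 // => j _.
by rewrite -scalemxAr mxtraceZ trW mulr0.
Qed.

(** * Submultiplicative norms *)

Lemma geometric_small (R : realType) (q C e : R) :
  0 <= q < 1 -> 0 < e -> exists k0, forall k, (k0 <= k)%N -> C * q ^+ k <= e.
Proof.
move=> /andP[q0 q1] e0.
have qcvg : ((fun k => C * q ^+ k) @ \oo --> (0 : R))%classic.
  rewrite -[X in (_ --> X)%classic](mulr0 C).
  by apply: cvgM; [exact: cvg_cst | apply: cvg_expr; rewrite ger0_norm].
by have [k0 _ k0P] := @cvgr_le R nat _ _ _ _ qcvg _ e0; exists k0.
Qed.

Lemma submult_norm0 (R : realType) (n : nat) (N : 'M[R]_n -> R) :
  submult_norm N -> N 0 = 0.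
Proof. by case=> _ NZ _ _; rewrite -(scale0r 0) NZ normr0 mul0r. Qed.

Lemma submult_norm_ge0 (R : realType) (n : nat) (N : 'M[R]_n -> R) X :
  submult_norm N -> 0 <= N X.
Proof.
move=> hN; have N0 := submult_norm0 hN; case: hN => _ NZ ND _.
have := ND X (-1 *: X); rewrite NZ normrN1 mul1r scaleN1r subrr N0.
by move=> ?; lra.
Qed.

Lemma submult_norm_sum (R : realType) (n : nat) (N : 'M[R]_n -> R) (I : Type)
    (r : seq I) (F : I -> 'M[R]_n) :
  submult_norm N -> N (\sum_(i <- r) F i) <= \sum_(i <- r) N (F i).
Proof.
move=> hN; have N0 := submult_norm0 hN; case: hN => _ _ ND _.
elim: r => [|i r IHr]; first by rewrite !big_nil N0.
by rewrite !big_cons (le_trans (ND _ _)) // lerD2l.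
Qed.

Lemma submult_norm_word (R : realType) (m n : nat) (N : 'M[R]_n -> R)
    (B : 'I_m -> 'M[R]_n) : submult_norm N ->
  exists2 b, 1 <= b &
    forall s : seq 'I_m, N (\prod_(i <- s) B i) <= N 1 * b ^+ size s.
Proof.
move=> hN; exists (1 + \sum_i N (B i)).
  by rewrite lerDl sumr_ge0 // => i _; exact: submult_norm_ge0.
have N_ge0 X : 0 <= N X by exact: submult_norm_ge0.
elim/last_ind => [|s i IHs]; first by rewrite big_nil expr0 mulr1.
rewrite big_rcons size_rcons exprSr mulrA /=; case: hN => _ _ _ NM.
rewrite (le_trans (NM _ _)) // ler_pM // (bigD1 i) //= addrCA lerDl.
by rewrite addr_ge0 // sumr_ge0.
Qed.

(** Let k be the block length. The product W s is a sum of terms E j,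
    0 <= j <= n, where E j collects the expansion terms with exactly j factors
    from the radical; it has its rows in U j and norm at most
    C3 c^|s| g^j. Appending a block Y + Z adds E j Y to the new E j and E j Z to
    the new E (j+1). The weight g absorbs the size of Z, which is not small: Y
    and Z each use up half of the factor c^k. The top term E n is 0 as
    U n = 0. *)
Lemma trace_bound_norm_bound (R : realType) (m n : nat) (N : 'M[R]_n -> R)
    (hN : submult_norm N) (B : 'I_m -> 'M[R]_n) (c1 c C : R) (k0 : nat) :
  0 < c1 < c -> 0 <= C ->
  (forall s : seq 'I_m, (k0 <= size s)%N ->
    `|\tr (\prod_(i <- s) B i)| <= C * c1 ^+ size s) ->
  exists2 C' : R, 0 <= C' &
    forall s : seq 'I_m, N (\prod_(i <- s) B i) <= C' * c ^+ size s.
Proof.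
move=> /andP[c1_gt0 lt_c1c] C_ge0; have c_gt0 := lt_trans c1_gt0 lt_c1c.
pose W (s : seq 'I_m) := \prod_(i <- s) B i; rewrite -/(W _) => trW.
have N_ge0 X : 0 <= N X by exact: submult_norm_ge0.
have NS := submult_norm_sum _ _ hN; have [b b_ge1 Nb] := submult_norm_word B hN.
have [_ NZ ND NM] := hN.
have W0 : W [::] = 1%:M by rewrite /W big_nil.
have WM s t : W (s ++ t) = W s *m W t by rewrite /W big_cat.
have [A [I [p [w [D [U [AY IZ [U0 Un AU IU]]]]]]]] :=
  word_trace_decomposition W0 WM.
pose Y t := \sum_i \tr (W (t ++ w i)) *: D i; pose Z t := W t - Y t.
pose C2 := \sum_i C * c1 ^+ size (w i) * N (D i).
have NY t : (k0 <= size t)%N -> N (Y t) <= C2 * c1 ^+ size t.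
  move=> k0t; apply: le_trans (NS _ _ _) _.
  rewrite mulr_suml ler_sum // => i _; rewrite NZ mulrAC ler_wpM2r //.
  rewrite (le_trans (trW _ _)) ?size_cat ?(leq_trans k0t) ?leq_addr //.
  by rewrite addnC exprD mulrA.
have ratio : 0 <= c1 / c < 1.
  by rewrite divr_ge0 ?(ltW c1_gt0) ?(ltW c_gt0) //= ltr_pdivrMr ?mul1r.
have half_gt0 : 0 < 2^-1 :> R by rewrite invr_gt0.
have [k1 k1P] := geometric_small C2 ratio half_gt0.
pose k := maxn k0.+1 k1; have k0k : (k0 < k)%N by exact: leq_maxl.
have kP := k1P k (leq_maxr _ _).
have ck_gt0 : 0 < c ^+ k by rewrite exprn_gt0.
have {}kP : C2 * c1 ^+ k <= c ^+ k / 2.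
  by move: kP; rewrite expr_div_n mulrA ler_pdivrMr // [_^-1 * _]mulrC.
(* Mz bounds the radical part of a block; g is chosen so that Mz is g times
   half of c^k. *)
pose Mz := N 1 * b ^+ k + c ^+ k / 2.
have NYk t : size t = k -> N (Y t) <= c ^+ k / 2.
  by move=> tk; rewrite (le_trans _ kP) // -tk NY // tk ltnW.
have NZk t : size t = k -> N (Z t) <= Mz.
  move=> tk; rewrite /Z -scaleN1r (le_trans (ND _ _)) // NZ normrN1 mul1r.
  by rewrite lerD ?NYk // -tk Nb.
have b_ge0 : 0 <= b by exact: le_trans b_ge1.
have bk_ge0 : 0 <= b ^+ k by rewrite exprn_ge0.
have Mz_ge0 : 0 <= Mz by rewrite addr_ge0 ?mulr_ge0 ?invr_ge0 // ltW.
pose g := 2 * Mz / c ^+ k.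
have g_ge0 : 0 <= g by rewrite divr_ge0 ?mulr_ge0 // ltW.
have gE : Mz = g * (c ^+ k / 2).
  by rewrite /g mulrA divfK ?gt_eqF // mulrAC divff ?mul1r.
(* C3 must cover every word shorter than a block, whether c < 1 or c >= 1. *)
pose d := Num.min 1 c; have d_gt0 : 0 < d by rewrite lt_min ltr01.
pose C3 := N 1 * b ^+ k / d ^+ k.
have C3_ge0 : 0 <= C3.
  by rewrite divr_ge0 ?mulr_ge0 // exprn_ge0 // ltW.
have bound_ge0 x j : 0 <= x -> 0 <= C3 * x * g ^+ j.
  by move=> x_ge0; rewrite mulr_ge0 ?exprn_ge0 // mulr_ge0.
have c_ge0 j : 0 <= c ^+ j by rewrite exprn_ge0 // ltW.
have key (s : seq 'I_m) : exists E : nat -> 'M[R]_n,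
  [/\ W s = \sum_(j < n.+1) E j, forall j, (E j <= U j)%MS &
      forall j, N (E j) <= C3 * c ^+ size s * g ^+ j].
  elim: (size s).+1 {-2}s (ltnSn (size s)) => // r IHr {}s; rewrite ltnS => s_r.
  have [sk|ks] := ltnP (size s) k.
    exists (fun j => if j is 0 then W s else 0); split.
    - by rewrite big_ord_recl big1 ?addr0.
    - by case=> [|j]; rewrite ?U0 ?submx1 ?sub0mx.
    - case=> [|j]; last first.
        by rewrite submult_norm0 // bound_ge0.
      rewrite expr0 mulr1 (le_trans (Nb s)) // /C3 -!mulrA ler_wpM2l //.
      apply: (@le_trans _ _ (b ^+ k)); first by rewrite ler_weXn2l // ltnW.
      rewrite ler_peMr // mulrC ler_pdivlMr ?exprn_gt0 // mul1r.
      apply: (@le_trans _ _ (d ^+ size s)).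
        by rewrite ler_wiXn2l ?ge_min ?lexx ?(ltW d_gt0) // ltnW.
      by rewrite lerXn2r ?nnegrE ?ge_min ?lexx ?orbT ?(ltW d_gt0) ?(ltW c_gt0).
  pose s' := take (size s - k) s; pose t := drop (size s - k) s.
  have tk : size t = k by rewrite size_drop subKn.
  have s'k : (size s' + k)%N = size s by rewrite size_takel ?leq_subr // subnK.
  have /IHr[E [WE EU NE]] : (size s' < r)%N.
    by rewrite (leq_trans _ s_r) // -s'k -addn1 leq_add2l (leq_trans _ k0k).
  exists (fun j => E j *m Y t + if j is j'.+1 then E j' *m Z t else 0); split.
  - have -> : W s = W s' *m Y t + W s' *m Z t.
      by rewrite -mulmxDr addrC subrK -WM cat_take_drop.
    rewrite big_split /= -mulmx_suml -WE; congr (_ + _).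
    rewrite big_ord_recl /= add0r {1}WE big_ord_recr /= mulmxDl mulmx_suml.
    have := EU n; rewrite Un submx0 => /eqP ->.
    by rewrite mul0mx addr0; apply: eq_bigr.
  - move=> j; rewrite addmx_sub //.
      by apply: submx_trans (submxMr _ (EU j)) (AU _ _ _); exact: AY.
    case: j => [|j]; rewrite ?sub0mx //.
    by apply: submx_trans (submxMr _ (EU j)) (IU _ _ _); exact: IZ.
  have NMk X X' a a' : N X <= a -> N X' <= a' -> N (X *m X') <= a * a'.
    by move=> ? ?; rewrite (le_trans (NM _ _)) // ler_pM.
  have NYt := NYk _ tk; have NZt := NZk _ tk.
  have -> : c ^+ size s = c ^+ size s' * (c ^+ k / 2) + c ^+ size s' * (c ^+ k / 2).
    by rewrite -s'k exprD -mulrDr -splitr.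
  move=> j; rewrite (le_trans (ND _ _)) // mulrDr mulrDl lerD //.
    by apply: le_trans (NMk _ _ _ _ (NE j) NYt) _; rewrite mulrA mulrAC.
  case: j => [|j].
    by rewrite submult_norm0 // bound_ge0 // mulr_ge0 // divr_ge0.
  apply: le_trans (NMk _ _ _ _ (NE j) NZt) _.
  rewrite gE [leLHS](_ : _ = C3 * (c ^+ size s' * (c ^+ k / 2)) * g ^+ j.+1) //.
  by rewrite exprS; ring.
exists (\sum_(j < n.+1) C3 * g ^+ j) => [|s].
  by rewrite sumr_ge0 // => j _; rewrite mulr_ge0 ?exprn_ge0.
have [E [WE _ NE]] := key s; rewrite -/(W s) WE (le_trans (NS _ _ _)) // mulr_suml.
by rewrite ler_sum // => j _; rewrite mulrAC.
Qed.

(** * Entries, eigenvalues and traces against norms *)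

(** Removes the multiplicative constant from a comparison of powers. *)
Lemma le_of_geometric_bound (R : realType) (a C q r : R) :
  0 < a -> 0 <= q -> (forall k, (0 < k)%N -> a * r ^+ k <= C * q ^+ k) -> r <= q.
Proof.
move=> a_gt0 q_ge0 rq; rewrite leNgt; apply/negP => lt_qr.
have r_gt0 := le_lt_trans q_ge0 lt_qr.
have ratio : 0 <= q / r < 1.
  by rewrite divr_ge0 ?(ltW r_gt0) //= ltr_pdivrMr ?mul1r.
have a2_gt0 : 0 < a / 2 by rewrite divr_gt0.
have [k0 k0P] := geometric_small C ratio a2_gt0.
have := k0P _ (leqnSn k0); rewrite expr_div_n mulrA ler_pdivrMr ?exprn_gt0 //.
move=> /(le_trans (rq _ (ltn0Sn k0))); rewrite ler_pM2r ?exprn_gt0 // => ?.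
by lra.
Qed.

(** Submultiplicativity makes this elementary, without the equivalence of norms
    in finite dimension: E_ii X E_jj = X_ij E_ij. *)
Lemma entry_le_submult_norm (R : realType) (n : nat) (N : 'M[R]_n -> R) :
  submult_norm N -> exists2 C : R, 0 <= C & forall (X : 'M[R]_n) i j, `|X i j| <= C * N X.
Proof.
move=> hN; have N_ge0 X : 0 <= N X by exact: submult_norm_ge0.
pose c i j := N (delta_mx i i) * N (delta_mx j j) / N (delta_mx i j).
have c_ge0 i j : 0 <= c i j by rewrite divr_ge0 ?mulr_ge0.
exists (\sum_i \sum_j c i j) => [|X i j].
  by rewrite sumr_ge0 // => i _; rewrite sumr_ge0.
apply: (@le_trans _ _ (c i j * N X)); last first.
  rewrite ler_wpM2r // (bigD1 i) //= (bigD1 j) //= -addrA lerDl.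
  by rewrite addr_ge0 ?sumr_ge0 // => i' _; rewrite sumr_ge0.
have [Ndef NZ _ NM] := hN.
have Ngt0 : 0 < N (delta_mx i j).
  rewrite lt_def N_ge0 andbT; apply/eqP => /Ndef/matrixP/(_ i j)/eqP.
  by rewrite !mxE !eqxx oner_eq0.
rewrite /c mulrAC ler_pdivlMr // -NZ mulrAC.
have -> : X i j *: delta_mx i j = delta_mx i i *m X *m delta_mx j j.
  have outer k : delta_mx k k = delta_mx k (0 : 'I_1) *m delta_mx 0 k :> 'M[R]_n.
    by rewrite mul_delta_mx.
  rewrite !outer !mulmxA -(mulmxA _ _ X) -rowE.
  rewrite -(mulmxA _ _ (delta_mx j 0)) -colE.
  have -> : col j (row i X) = (X i j)%:M by rewrite [LHS]mx11_scalar !mxE.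
  by rewrite mul_mx_scalar -scalemxAl mul_delta_mx.
by rewrite (le_trans (NM _ _)) // ler_wpM2r.
Qed.

Lemma submult_norm_le_entries (R : realType) (n : nat) (N : 'M[R]_n -> R) X :
  submult_norm N -> N X <= \sum_i \sum_j `|X i j| * N (delta_mx i j).
Proof.
move=> hN; rewrite {1}(matrix_sum_delta X).
apply: le_trans (submult_norm_sum _ _ hN) _; rewrite ler_sum // => i _.
apply: le_trans (submult_norm_sum _ _ hN) _; rewrite ler_sum // => j _.
by case: hN => _ ->.
Qed.

Lemma normc_ge0 (R : realType) (z : R[i]) : 0 <= ComplexField.Normc.normc z.
Proof. by case: z => a b; exact: sqrtr_ge0. Qed.

Lemma normcX (R : realType) (z : R[i]) k :
  ComplexField.Normc.normc (z ^+ k) = ComplexField.Normc.normc z ^+ k.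
Proof.
elim: k => [|k IHk]; first exact: ComplexField.Normc.normc1.
by rewrite !exprS ComplexField.Normc.normcM IHk.
Qed.

Lemma normc_sum (R : realType) (I : Type) (r : seq I) (F : I -> R[i]) :
  ComplexField.Normc.normc (\sum_(i <- r) F i) <=
  \sum_(i <- r) ComplexField.Normc.normc (F i).
Proof.
elim: r => [|i r IHr]; first by rewrite !big_nil ComplexField.Normc.normc0.
by rewrite !big_cons (le_trans (le_normcD _ _)) // lerD2l.
Qed.

Lemma normc_real (R : realType) (x : R) :
  ComplexField.Normc.normc (real_complex R x) = `|x|.
Proof. by rewrite /= expr0n addr0 sqrtr_sqr. Qed.

(** The norm N only sees real matrices, so it cannot be evaluated on a complex
    eigenvector. Instead, one coordinate of v X^k = z^k v bounds |z|^k by a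
    constant times N(X)^k, through the entries of X^k. *)
Lemma eigenvalue_le_submult_norm (R : realType) (n : nat) (N : 'M[R]_n -> R)
    (X : 'M[R]_n) (z : R[i]) : submult_norm N ->
  eigenvalue (map_mx (real_complex R) X) z ->
  ComplexField.Normc.normc z <= N X.
Proof.
move=> hN /eigenvalueP[v vX v0]; have [C C_ge0 CP] := entry_le_submult_norm hN.
have [j vj0] := rV0Pn _ v0.
have vXk k : v *m map_mx (real_complex R) (X ^+ k) = z ^+ k *: v.
  elim: k => [|k IHk]; first by rewrite !expr0 map_mx1 mulmx1 scale1r.
  by rewrite !exprSr -mulmxE map_mxM mulmxA IHk -scalemxAl vX scalerA.
have N_ge0 Y : 0 <= N Y by exact: submult_norm_ge0.
have NX k : N (X ^+ k.+1) <= N X ^+ k.+1.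
  elim: k => [|k IHk]; first by rewrite !expr1.
  rewrite exprS [leRHS]exprS -mulmxE; case: hN => _ _ _ NM.
  by rewrite (le_trans (NM _ _)) // ler_wpM2l.
apply: (@le_of_geometric_bound _ (ComplexField.Normc.normc (v 0 j))
  (\sum_i ComplexField.Normc.normc (v 0 i) * C)).
- rewrite lt_def normc_ge0 andbT; apply: contra vj0 => /eqP.
  by move=> /ComplexField.Normc.eq0_normc ->.
- exact: submult_norm_ge0.
case=> // k _; rewrite -normcX mulrC -ComplexField.Normc.normcM.
have := congr1 (fun u : 'rV_n => u 0 j) (vXk k.+1); rewrite !mxE => <-.
apply: le_trans (normc_sum _ _) _; rewrite mulr_suml ler_sum // => i _.
rewrite ComplexField.Normc.normcM mxE normc_real -mulrA ler_wpM2l ?normc_ge0 //.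
by rewrite (le_trans (CP _ _ _)) // ler_wpM2l.
Qed.

Lemma spectral_radius_le_submult_norm (R : realType) (n : nat)
    (N : 'M[R]_n -> R) X : submult_norm N -> spectral_radius X <= N X.
Proof.
move=> hN; rewrite /spectral_radius; set S := (X in sup X).
have [->|S0] := eqVneq S set0; first by rewrite sup0 submult_norm_ge0.
apply: ge_sup; first exact/set0P.
by move=> _ [z zX ->]; exact: eigenvalue_le_submult_norm.
Qed.

Lemma trace_le_spectral_radius (R : realType) (n : nat) (X : 'M[R]_n) :
  `|\tr X| <= n%:R * spectral_radius X.
Proof.
have [n0|n_gt0] := posnP n; first by subst n; rewrite /mxtrace big_ord0 normr0 mul0r.
set Xc := map_mx (real_complex R) X.
have [r rE] := closed_field_poly_normal (char_poly Xc).
rewrite (monicP (char_poly_monic _)) scale1r in rE.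
have size_r : size r = n.
  by have := size_char_poly Xc; rewrite rE size_prod_XsubC => -[].
have eigE z : eigenvalue Xc z = (z \in r).
  by rewrite eigenvalue_root_char rE root_prod_XsubC.
have rho z : z \in r -> ComplexField.Normc.normc z <= spectral_radius X.
  move=> zr; apply: ub_le_sup; last by exists z => //; rewrite eigE.
  exists (\sum_(y <- r) ComplexField.Normc.normc y) => _ [y yr ->].
  rewrite eigE in yr; rewrite (big_rem y) //= lerDl.
  by rewrite sumr_ge0 // => ? _; exact: normc_ge0.
have trE : real_complex R (\tr X) = \sum_(z <- r) z.
  have := char_poly_trace Xc n_gt0; rewrite rE -{1}size_r.
  rewrite coefPn_prod_XsubC ?size_r -?lt0n // => /oppr_inj ->.
  by rewrite trace_map_mx.
rewrite -normc_real trE (le_trans (normc_sum _ _)) //.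
apply: le_trans (_ : \sum_(z <- r) spectral_radius X <= _).
  by rewrite big_seq [leRHS]big_seq ler_sum.
by rewrite big_const_seq count_predT size_r iter_addr_0 mulr_natl lexx.
Qed.

(** * Growth rates *)

(** Comparing two growth rates with some room c1 < c lets multiplicative
    constants and finitely many terms be ignored. *)
Lemma limsup_root_le (R : realType) (u v : nat -> R) :
  (forall k, 0 <= u k) -> (forall k, 0 <= v k) ->
  (forall c1 c : R, 0 < c1 < c ->
     (exists k0, forall k, (k0 <= k)%N -> v k <= c1 ^+ k) ->
     exists (C : R) k0, forall k, (k0 <= k)%N -> u k <= C * c ^+ k) ->
  (limsup_root u <= limsup_root v)%E.
Proof.
move=> u_ge0 v_ge0 uv.
have rootE (x : R) k : 0 <= x -> (0 < k)%N -> (x `^ k%:R^-1) ^+ k = x.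
  move=> x_ge0 k_gt0; rewrite -powR_mulrn ?powR_ge0 // -powRrM.
  by rewrite mulVf ?powRr1 // pnatr_eq0 -lt0n.
have : (0 <= limsup_root v)%E.
  apply: limf_esup_ge0; first by case=> k0 _ /(_ k0)/(_ (leqnn _)).
  by move=> k; rewrite lee_fin powR_ge0.
case vE : (limsup_root v) => [r| |] // r_ge0; last by rewrite leey.
rewrite lee_fin in r_ge0.
apply/lee_addgt0Pr => e e_gt0; rewrite -EFinD.
pose c1 := r + e / 3; pose c := r + e / 2; pose c2 := r + e.
have c1_gt0 : 0 < c1 by rewrite /c1; lra.
have c1c : c1 < c by rewrite /c1 /c; lra.
have cc2 : c < c2 by rewrite /c /c2; lra.
have [||C [k0 k0P]] := uv c1 c; first by rewrite c1_gt0.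
  have : (limsup_root v < c1%:E)%E by rewrite vE lte_fin /c1; lra.
  move=> /ereal_inf_lt[_ [V [k0 _ k0V] <-] Vlt].
  exists k0.+1 => k k0k; rewrite -(rootE (v k) k) ?(leq_trans _ k0k) //.
  rewrite lerXn2r ?nnegrE ?powR_ge0 ?(ltW c1_gt0) // -lee_fin.
  apply: le_trans (ltW Vlt); apply: ereal_sup_ubound; exists k => //.
  by apply: k0V; exact: ltnW.
have c_gt0 := lt_trans c1_gt0 c1c; have c2_gt0 := lt_trans c_gt0 cc2.
have ratio : 0 <= c / c2 < 1.
  by rewrite divr_ge0 ?(ltW c_gt0) ?(ltW c2_gt0) //= ltr_pdivrMr ?mul1r.
have [k1 k1P] := geometric_small C ratio ltr01.
pose V := [set k | (maxn (maxn k0 k1) 1 <= k)%N]%classic.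
apply: (@le_trans _ _ (ereal_sup ((fun k => (u k `^ k%:R^-1)%:E) @` V)%classic)).
  by apply: ereal_inf_lbound; exists V => //; exists (maxn (maxn k0 k1) 1).
apply: ge_ereal_sup => _ [k /= + <-]; rewrite /V /= !geq_max.
move=> /andP[/andP[k0k k1k] k_gt0].
rewrite lee_fin -(ler_pXn2r k_gt0) ?nnegrE ?powR_ge0 ?(ltW c2_gt0) //.
rewrite rootE // (le_trans (k0P _ k0k)) //.
have := k1P _ k1k; rewrite expr_div_n mulrA ler_pdivrMr ?exprn_gt0 //.
by rewrite mul1r.
Qed.

Lemma limsup_root_scaled_le (R : realType) (C : R) (u v : nat -> R) : 0 <= C ->
  (forall k, 0 <= u k) -> (forall k, 0 <= v k) -> (forall k, u k <= C * v k) ->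
  (limsup_root u <= limsup_root v)%E.
Proof.
move=> C_ge0 u_ge0 v_ge0 uv; apply: limsup_root_le => // c1 c /andP[c1_gt0 c1c].
move=> [k0 k0P]; exists C, k0 => k k0k; apply: le_trans (uv k) _.
rewrite ler_wpM2l // (le_trans (k0P _ k0k)) // lerXn2r ?nnegrE ?(ltW c1c) //.
  exact: ltW.
by rewrite ltW // (lt_trans c1_gt0).
Qed.

Lemma bigmax0_ge0 (R : realType) (I : finType) (P : pred I) (F : I -> R) :
  0 <= \big[Num.max/0]_(i | P i) F i.
Proof. exact: bigmax_ge_id. Qed.

(** * From traces to the joint spectral radius *)

Lemma jsr_le_of_trace (R : realType) (m n : nat) (N : 'M[R]_n -> R)
    (hN : submult_norm N) (B : 'I_m -> 'M[R]_n) (C : R) (v : nat -> R) :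
  0 <= C -> (forall k, 0 <= v k) ->
  (forall k (s : k.-tuple 'I_m), `|\tr (mxword B s)| <= C * v k) ->
  (jsr N B <= limsup_root v)%E.
Proof.
move=> C_ge0 v_ge0 trB; apply: limsup_root_le => // [k|c1 c c1c [k0 k0P]].
  exact: bigmax0_ge0.
have [|C' C'_ge0 NB] := trace_bound_norm_bound hN c1c C_ge0 (B := B) (k0 := k0).
  move=> s k0s; have := trB _ (rev_tuple (in_tuple s)).
  rewrite /mxword /= revK => /le_trans; apply.
  by rewrite ler_wpM2l // k0P.
have c_ge0 : 0 <= c by case/andP: c1c => c1_gt0 /(lt_trans c1_gt0)/ltW.
exists C', 0%N => k _; apply: bigmax_le => [|s _].
  by rewrite mulr_ge0 ?exprn_ge0.
by rewrite /mxword (le_trans (NB _)) // size_rev size_tuple.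
Qed.

Lemma gsr_le_jsr (R : realType) (m n : nat) (N : 'M[R]_n -> R)
    (hN : submult_norm N) (B : 'I_m -> 'M[R]_n) : (gsr B <= jsr N B)%E.
Proof.
apply: (@limsup_root_scaled_le _ 1) => // k; rewrite ?bigmax0_ge0 // mul1r.
by apply: le_bigmax2 => s _; exact: spectral_radius_le_submult_norm.
Qed.

(** The nontrivial half of the Berger-Wang theorem. *)
Lemma jsr_le_gsr (R : realType) (m n : nat) (N : 'M[R]_n -> R)
    (hN : submult_norm N) (B : 'I_m -> 'M[R]_n) : (jsr N B <= gsr B)%E.
Proof.
apply: (@jsr_le_of_trace _ _ _ _ hN _ n%:R) => // [k|k s].
  exact: bigmax0_ge0.
rewrite (le_trans (trace_le_spectral_radius _)) // ler_wpM2l //.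
exact: (le_bigmax_cond _ (fun s : k.-tuple _ => spectral_radius (mxword B s))).
Qed.

Lemma cgsr_le_cjsr (R : realType) (l m n : nat) (N : 'M[R]_n -> R)
    (hN : submult_norm N) (A : 'I_m -> 'M[R]_n) (M : dfa l m) :
  (cgsr A M <= cjsr N A M)%E.
Proof.
apply: (@limsup_root_scaled_le _ 1) => // k; rewrite ?bigmax0_ge0 // mul1r.
by apply: le_bigmax2 => s _; exact: spectral_radius_le_submult_norm.
Qed.

(** * The automaton and the lifted matrices *)

Definition dfa_run (l m : nat) (M : dfa l m) (q : 'I_l) (s : seq 'I_m) :
    option 'I_l :=
  foldl (fun o u => obind (fun p => dfa_trans M p u) o) (Some q) s.

Lemma dfa_run_rcons (l m : nat) (M : dfa l m) q (s : seq 'I_m) u :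
  dfa_run M q (rcons s u) = obind (fun p => dfa_trans M p u) (dfa_run M q s).
Proof. by rewrite /dfa_run -cats1 foldl_cat. Qed.

Lemma dfa_run_take (l m : nat) (M : dfa l m) q (s : seq 'I_m) i :
  dfa_run M q (take i s) = None -> dfa_run M q s = None.
Proof.
rewrite -{2}(cat_take_drop i s) /dfa_run foldl_cat => ->.
by elim: (drop i s).
Qed.

Lemma acceptedP (l m : nat) (M : dfa l m) k (s : k.-tuple 'I_m) :
  reflect (exists q, dfa_run M q s <> None) (accepted M s).
Proof.
have take_tnth (i : 'I_k) : take i.+1 s = rcons (take i s) (tnth s i).
  by rewrite (tnth_nth (tnth s i)) -take_nth // size_tuple.
apply: (iffP existsP) => [[q /forallP qP]|[q0 run_q0]].
  exists (q ord0).
  suff run_q (i : 'I_k.+1) : dfa_run M (q ord0) (take i s) = Some (q i).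
    by have := run_q ord_max; rewrite /= take_oversize ?size_tuple // => ->.
  case: i => i; elim: i => [|i IHi] lt_ik /=.
    by rewrite take0; congr (Some (q _)); exact: val_inj.
  rewrite (take_tnth (Ordinal (lt_ik : i < k)%N)) dfa_run_rcons.
  rewrite (IHi (ltnW lt_ik)) /=.
  have /eqP := qP (Ordinal (lt_ik : i < k)%N).
  rewrite (_ : widen_ord _ _ = Ordinal (ltnW lt_ik)); last exact: val_inj.
  by rewrite (_ : lift _ _ = Ordinal lt_ik) //; exact: val_inj.
exists [ffun i : 'I_k.+1 => odflt q0 (dfa_run M q0 (take i s))].
apply/forallP => i; rewrite !ffunE /= /bump leq0n add1n take_tnth dfa_run_rcons.
case run_i : (dfa_run M q0 (take i s)) => [p|] /=; last first.
  by case: run_q0; exact: dfa_run_take run_i.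
case run_Si : (dfa_trans M p (tnth s i)) => [p'|] //=.
case: run_q0; apply: (@dfa_run_take _ _ _ _ _ i.+1).
by rewrite take_tnth dfa_run_rcons run_i.
Qed.

(** Words act on the states as partial functions, so the product of the
    transition matrices has at most one nonzero entry per column, equal to 1. *)
Lemma trans_mxword (R : realType) (l m : nat) (M : dfa l m) (s : seq 'I_m) q' q :
  mxword (trans_mx R M) s q' q = (dfa_run M q s == Some q')%:R.
Proof.
rewrite /mxword; elim/last_ind: s q' => [|s u IHs] q'.
  by rewrite big_nil mxE eq_sym.
rewrite rev_rcons big_cons dfa_run_rcons.
move: (\prod_(i <- rev s) _) IHs => P IHs; rewrite mxE.
under eq_bigr do rewrite IHs mxE.
case: (dfa_run M q s) => [p|] /=; last first.
  by rewrite big1 // => j _; rewrite mulr0.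
rewrite (bigD1 p) //= eqxx mulr1 big1 ?addr0 // => j jp.
case: (Some p =P Some j) => [[pj]|_]; last exact: mulr0.
by rewrite pj eqxx in jp.
Qed.

Lemma lifted_mxword (R : realType) (l m n : nat) (A : 'I_m -> 'M[R]_n)
    (M : dfa l m) (s : seq 'I_m) :
  mxword (lifted_mx A M) s = mxword (trans_mx R M) s *t mxword A s.
Proof.
rewrite /mxword; elim: (rev s) => [|u r IHr]; last first.
  by rewrite !big_cons IHr -!mulmxE -tensmx_mul.
rewrite !big_nil; apply/matrixP => i j.
case: (mxtens_indexP i) => i1 i2; case: (mxtens_indexP j) => j1 j2.
by rewrite tensmxE !mxE (can_eq (@mxtens_indexK _ _)) xpair_eqE -natrM mulnb.
Qed.

Lemma mxtrace_tens (R : comPzRingType) (l n : nat) (F : 'M[R]_l) (X : 'M[R]_n) :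
  \tr (F *t X) = \tr F * \tr X.
Proof. by rewrite /mxtrace mulr_sum; apply: eq_bigr => k _; rewrite mxE. Qed.

(** An accepted word s runs from some state q to some q', and then A_s is the
    (q', q) block of the lifted product. *)
Lemma cjsr_le_jsr_lifted (R : realType) (l m n : nat) (A : 'I_m -> 'M[R]_n)
    (M : dfa l m) (N : 'M[R]_n -> R) (N' : 'M[R]_(l * n) -> R) :
  submult_norm N -> submult_norm N' ->
  (cjsr N A M <= jsr N' (lifted_mx A M))%E.
Proof.
move=> hN hN'; have [C C_ge0 CP] := entry_le_submult_norm hN'.
have N_ge0 X : 0 <= N X by exact: submult_norm_ge0.
pose D := \sum_i \sum_j N (delta_mx i j).
have D_ge0 : 0 <= D by rewrite sumr_ge0 // => i _; rewrite sumr_ge0.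
apply: (@limsup_root_scaled_le _ (C * D)) => [|k|k|k]; rewrite ?bigmax0_ge0 ?mulr_ge0 //.
apply: bigmax_le => [|s]; first by rewrite !mulr_ge0 ?bigmax0_ge0.
case/acceptedP => q; case run_q : (dfa_run M q s) => [q'|] // _.
apply: (@le_trans _ _ (C * D * N' (mxword (lifted_mx A M) s))); last first.
  rewrite ler_wpM2l ?mulr_ge0 //.
  exact: (le_bigmax_cond _ (fun s : k.-tuple _ => N' (mxword (lifted_mx A M) s))).
apply: le_trans (submult_norm_le_entries _ hN) _.
rewrite mulrAC mulr_sumr ler_sum // => i _; rewrite mulr_sumr ler_sum // => j _.
rewrite ler_wpM2r //; apply: le_trans (CP _ (mxtens_index (q', i)) (mxtens_index (q, j))).
by rewrite lifted_mxword tensmxE trans_mxword run_q eqxx mul1r.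
Qed.

(** Traces avoid comparing the spectrum of a Kronecker product with that of its
    factors: tr F_s is at most l, and it is 0 when s is not accepted. *)
Lemma jsr_lifted_le_cgsr (R : realType) (l m n : nat) (A : 'I_m -> 'M[R]_n)
    (M : dfa l m) (N' : 'M[R]_(l * n) -> R) :
  submult_norm N' -> (jsr N' (lifted_mx A M) <= cgsr A M)%E.
Proof.
move=> hN'.
apply: (@jsr_le_of_trace _ _ _ _ hN' _ (l%:R * n%:R)) => [|k|k s].
- by rewrite mulr_ge0.
- exact: bigmax0_ge0.
rewrite lifted_mxword mxtrace_tens normrM -mulrA.
have [acc|nacc] := boolP (accepted M s); last first.
  rewrite [\tr _]big1 ?normr0 ?mul0r ?mulr_ge0 ?bigmax0_ge0 // => q _.
  rewrite trans_mxword; case run_q : (dfa_run M q s) => [p|] //.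
  by case/acceptedP: nacc; exists q; rewrite run_q.
apply: ler_pM => //.
  rewrite (le_trans (ler_norm_sum _ _ _)) // -[X in _ <= X%:R]card_ord -sumr_const.
  by rewrite ler_sum // => q _; rewrite trans_mxword; case: eqP; rewrite ?normr1 ?normr0.
rewrite (le_trans (trace_le_spectral_radius _)) // ler_wpM2l //.
exact: (le_bigmax_cond _ (fun s : k.-tuple _ => spectral_radius (mxword A s))).
Qed.

Theorem theorem2 (R : realType) (n m l : nat)
    (hn : (0 < n)%N) (hm : (0 < m)%N) (hl : (0 < l)%N)
    (A : 'I_m -> 'M[R]_n) (M : dfa l m)
    (N : 'M[R]_n -> R) (hN : submult_norm N)
    (N' : 'M[R]_(l * n) -> R) (hN' : submult_norm N') :
  [/\ cjsr N A M = cgsr A M,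
      cgsr A M = jsr N' (lifted_mx A M)
    & jsr N' (lifted_mx A M) = gsr (lifted_mx A M)].
Proof.
have cg_cj := cgsr_le_cjsr hN A M.
have cj_j := cjsr_le_jsr_lifted A M hN hN'.
have j_cg := jsr_lifted_le_cgsr A M hN'.
split; apply/eqP; rewrite eq_le.
- by rewrite cg_cj (le_trans cj_j).
- by rewrite j_cg (le_trans cg_cj).
- by rewrite jsr_le_gsr // gsr_le_jsr.
Qed.
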